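(* Let $M:(0,\infty)\times(0,\infty)\to(0,\infty)$ and $N:(-\infty,\infty)\times(-\infty,\infty)\to(-\infty,\infty)$ be two symmetric, homogeneous and differentiable means, and let $r$ be a real function defined on $(0,\infty)$ with $\lim_{x\to\infty}r(x)=0$. Then for fixed real numbers $\theta,\theta^{\ast},\sigma,\sigma^{\ast}$ with $\theta+\theta^{\ast}=\sigma+\sigma^{\ast}=1$ (and $x>-\min(1,\theta,\theta^{\ast})$), we have $$\Gamma(x+1)\sim\sqrt{2\pi}\,M(x+\theta,x+\theta^{\ast})^{x+1/2}\,e^{-N(x+\sigma,x+\sigma^{\ast})}\,e^{r(x)}\quad\text{as }x\to\infty.$$
   Context: $\Gamma$ is Euler's gamma function. For an interval $I\subseteq\mathbb{R}$, a function $M:I^2\to\mathbb{R}$ is a (bivariate) mean if $\min(a,b)\le M(a,b)\le\max(a,b)$ for all $a,b\in I$. It is symmetric if $M(a,b)=M(b,a)$ for all $a,b\in I$, and homogeneous (of degree one) if $M(ta,tb)=tM(a,b)$ for all $a,b\in I$ and $t>0$. Differentiable means differentiable as a function of two variables. The notation $f(x)\sim g(x)$ as $x\to\infty$ means $\lim_{x\to\infty}f(x)/g(x)=1$. *)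

(* Defs.v *)
From mathcomp Require Import all_boot all_order all_algebra.
From mathcomp Require Import all_classical all_reals all_analysis.
Set Implicit Arguments.
Unset Strict Implicit.
Unset Printing Implicit Defensive.
Import Order.TTheory GRing.Theory Num.Theory.
Import numFieldNormedType.Exports.

Local Open Scope classical_set_scope.
Local Open Scope ring_scope.

(* Euler's integral: this is the gamma function for 0 < x only, not its
   continuation to the negative axis. *)
Definition Gamma (R : realType) (x : R) : R :=
  \int[@lebesgue_measure R]_(t in `]0, +oo[) (t `^ (x - 1) * expR (- t)).

(* A function on I ^ 2 is represented by a total function M : R -> R -> R whose
   values outside I ^ 2 are unconstrained. *)
Definition is_mean (R : realType) (I : set R) (M : R -> R -> R) : Prop :=
  forall a b, I a -> I b -> Num.min a b <= M a b <= Num.max a b.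

Definition symmetric_on (R : realType) (I : set R) (M : R -> R -> R) : Prop :=
  forall a b, I a -> I b -> M a b = M b a.

(* Meant for I closed under multiplication by positive scalars. *)
Definition homogeneous_on (R : realType) (I : set R) (M : R -> R -> R) : Prop :=
  forall a b t, I a -> I b -> 0 < t -> M (t * a) (t * b) = t * M a b.

(* Fréchet differentiability at the points of I ^ 2; since it looks at M in a
   full neighbourhood of each point, it is meant for open I. *)
Definition differentiable_on (R : realType) (I : set R) (M : R -> R -> R) : Prop :=
  forall a b, I a -> I b ->
    differentiable (fun p : R * R => M p.1 p.2) (a, b).

Definition asymptotic_on (R : realType) (D : set R) (f g : R -> R) : Prop :=
  f x / g x @[x --> within D (pinfty_nbhs R)] --> (1 : R).

(* Main.v *)
(**
  Substituting [t = x + s * u] with [s = sqrt (2 * x)] in Euler's integral for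
  [Gamma (x + 1)] produces the factor [x ^ x * e ^ - x * s] times the integral
  over [u] of a kernel that tends pointwise to the Gaussian [e ^ - u ^ 2]; since
  [ln (1 + y) - y] lies between [- y ^ 2 / 2] and [- y ^ 2 / (2 * (1 + y))], the
  kernel is dominated by [4 / (1 + u ^ 2)] once [2 <= s], and dominated
  convergence yields Stirling's formula.

  A symmetric mean that is differentiable at [(1, 1)] has both partial
  derivatives equal to [1 / 2] there, so by homogeneity
  [M (x + a) (x + b) = x + (a + b) / 2 + o(1)]. With [a + b = 1] this is
  [x + 1 / 2 + o(1)] for both means, and
  [(x + 1 / 2) * ln (M / x)] tends to [1 / 2], which [N - x] compensates.
*)
Require Import Defs.
From mathcomp Require Import all_boot all_order all_algebra.
From mathcomp Require Import all_classical all_reals all_analysis.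
From mathcomp Require Import measurable_realfun ring lra.

Set Implicit Arguments.
Unset Strict Implicit.
Unset Printing Implicit Defensive.
Import Order.TTheory GRing.Theory Num.Theory.
Import numFieldNormedType.Exports.

Local Open Scope classical_set_scope.
Local Open Scope ring_scope.

(** * Elementary bounds on the logarithm near 1 *)

Lemma ln1D_lb (R : realType) (y : R) : -1 < y -> y / (1 + y) <= ln (1 + y).
Proof.
move=> y1; have y0 : 0 < 1 + y by lra.
(* The upper bound [ln (1 + z) <= z], taken at the [z] for which [1 + z] is the inverse of
   [1 + y]. *)
have : ln (1 + (- y / (1 + y))) <= - y / (1 + y).
  apply: le_ln1Dx; rewrite ltr_pdivlMr//; lra.
have -> : 1 + - y / (1 + y) = (1 + y)^-1 by field; lra.
rewrite lnV ?posrE// mulNr; lra.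
Qed.

Section ln1D_quadratic.
Context {R : realType}.
Implicit Types y : R.

Let is_derive_ln1D y : -1 < y -> is_derive y 1 (fun z => ln (1 + z)) (1 + y)^-1.
Proof.
move=> y1.
have l : is_derive (1 + y) 1 (@ln R) (1 + y)^-1 by apply: is_derive1_ln; lra.
have a : is_derive y 1 (fun z : R => 1 + z) 1.
  by rewrite -[X in is_derive _ _ _ X]add0r; apply: is_deriveD.
have := @is_derive1_comp R (@ln R) (fun z => 1 + z) y (1 + y)^-1 1 l a.
by rewrite mulr1.
Qed.

(** By the mean value theorem [g y = dg c * y] for some [c] between 0 and [y], so
    [y * g y = dg c * y ^ 2]. *)
Let monotone_from0 (g dg : R -> R) :
  (forall y, -1 < y -> is_derive y 1 g (dg y)) -> (forall y, -1 < y -> 0 <= dg y) ->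
  g 0 = 0 -> forall y, -1 < y -> 0 <= y * g y.
Proof.
move=> g' dg0 g0 y y1.
have cg a b : -1 < a -> {within `[a, b], continuous g}.
  move=> a1; apply: derivable_within_continuous => z /[!in_itv]/= /andP[az zb].
  by have [] : is_derive z 1 g (dg z) by apply: g'; lra.
have [y0|y0] := leP 0 y.
  have [||c] := @MVT_segment _ g dg 0 y y0.
  - by move=> z /[!in_itv]/= /andP[? ?]; apply: g'; lra.
  - by apply: cg; lra.
  rewrite in_itv/= => /andP[c0 cy]; rewrite g0 !subr0 => ->.
  by rewrite !mulr_ge0// dg0//; lra.
have [||c] := @MVT_segment _ g dg y 0 (ltW y0).
- by move=> z /[!in_itv]/= /andP[? ?]; apply: g'; lra.
- exact: cg.
rewrite in_itv/= => /andP[yc c0]; rewrite g0 => E.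
have d0 : 0 <= dg c by apply: dg0; lra.
have -> : g y = dg c * y by lra.
by rewrite mulrCA -expr2 mulr_ge0 ?sqr_ge0.
Qed.

(* The factor [y] records both signs at once: the bounds on [ln (1 + y) - y]
   swap when [y] changes sign. *)
Let sign_ln1D_lb y : -1 < y -> 0 <= y * (ln (1 + y) - y + y ^+ 2 / 2).
Proof.
apply: (@monotone_from0 (fun y => ln (1 + y) - y + y ^+ 2 / 2) (fun y => y ^+ 2 / (1 + y))).
- move=> z z1; have := is_derive_ln1D z1 => l.
  by apply: is_derive_eq; rewrite /GRing.scale/=; field; lra.
- move=> z z1; rewrite divr_ge0 ?sqr_ge0//; lra.
- by rewrite addr0 ln1 expr0n/= mul0r subr0 addr0.
Qed.

Let sign_ln1D_ub y : -1 < y -> 0 <= y * (- (ln (1 + y) - y + y ^+ 2 / (2 * (1 + y)))).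
Proof.
apply: (@monotone_from0 (fun y => - (ln (1 + y) - y + y ^+ 2 / (2 * (1 + y))))
  (fun y => y ^+ 2 / (2 * (1 + y) ^+ 2))).
- move=> z z1; have := is_derive_ln1D z1 => l.
  have n0 : 2 * (1 + z) != 0 by lra.
  by apply: is_derive_eq; rewrite /GRing.scale/=; field; lra.
- move=> z z1; rewrite divr_ge0 ?sqr_ge0// mulr_ge0 ?sqr_ge0//.
- by rewrite addr0 ln1 expr0n/= mul0r subr0 addr0 oppr0.
Qed.

(** The absolute value makes one formula serve both signs: for [y > 0] it is the signed upper bound
    itself, and for [y < 0] it is weaker than the available [- y ^ 2 / 2]. *)
Lemma ln1D_quadratic_ub y : -1 < y ->
  ln (1 + y) - y <= - (y ^+ 2 / (2 * (1 + `|y|))).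
Proof.
move=> y1; have := sign_ln1D_lb y1; have := sign_ln1D_ub y1.
have [->|] := eqVneq y 0; first by move=> _ _; rewrite addr0 ln1 expr0n/= mul0r subrr oppr0.
rewrite neq_lt => /orP[y0|y0].
  rewrite nmulr_rge0// nmulr_rge0// ltr0_norm// => _ h.
  have : y ^+ 2 / (2 * (1 - y)) <= y ^+ 2 / 2.
    by rewrite ler_wpM2l ?sqr_ge0// lef_pV2 ?posrE; lra.
  lra.
rewrite pmulr_rge0// gtr0_norm//; lra.
Qed.

(** The right-hand side is the distance between the two signed bounds, computed in [E]. *)
Lemma ln1D_quadratic_dist y : -1 < y ->
  `|ln (1 + y) - y + y ^+ 2 / 2| <= `|y| ^+ 3 / (2 * (1 + y)).
Proof.
move=> y1; have := sign_ln1D_lb y1; have := sign_ln1D_ub y1.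
have E : y ^+ 2 / 2 - y ^+ 2 / (2 * (1 + y)) = y ^+ 3 / (2 * (1 + y)) by field; lra.
have [->|] := eqVneq y 0.
  by move=> _ _; rewrite addr0 ln1 normr0 !expr0n/= !mul0r subrr addr0 normr0.
rewrite neq_lt => /orP[y0|y0].
  rewrite !nmulr_rge0// (ltr0_norm y0) [(- y) ^+ 3]exprNn -signr_odd/= expr1 mulN1r => h h'.
  rewrite ler0_norm//; lra.
rewrite !pmulr_rge0// (gtr0_norm y0) => h h'.
rewrite ger0_norm//; lra.
Qed.
End ln1D_quadratic.

(** * Euler's integrand on the whole line *)

Section gamma_integrand.
Context {R : realType}.
Let mu := @lebesgue_measure R.

(** This is the dominating function for the Laplace kernels. Its integrability comes from the known
    integral over the half-line, doubled by evenness. *)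
Lemma integrable_4oneDsqrV : mu.-integrable setT (fun u => (4 * (1 + u ^+ 2)^-1)%:E).
Proof.
have c1 : continuous (fun u : R => (1 + u ^+ 2)^-1) by exact: continuous_oneDsqrV.
have := @ge0_symfun_integralT R (fun u : R => (1 + u ^+ 2)^-1).
rewrite -set_itvcy integral0y_oneDsqr => H.
under eq_fun do rewrite EFinM.
apply: integrableZl => //.
apply/integrableP; split; first by apply/measurable_EFinP; exact: continuous_measurable_fun.
under eq_integral => u _ do rewrite gee0_abs ?lee_fin ?invr_ge0 ?addr_ge0 ?sqr_ge0//.
rewrite H ?ltry//.
- by move=> u; rewrite invr_ge0 addr_ge0 ?sqr_ge0.
- by move=> u; rewrite /= sqrrN.
Qed.

(* Since [t `^ x] is [1] rather than [0] for [t < 0], the truncation is needed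
   to integrate over the whole line. *)
Definition gamma_integrand (x t : R) := Num.max t 0 `^ x * expR (- t).

Lemma gamma_integrand_ge0 x t : 0 <= gamma_integrand x t.
Proof. by rewrite mulr_ge0 ?powR_ge0 ?expR_ge0. Qed.

Lemma continuous_gamma_integrand x : 0 < x -> continuous (gamma_integrand x).
Proof.
move=> x0 t; apply: cvgM; last first.
  by apply: continuous_comp; [exact: cvgN | exact: continuous_expR].
have cmax : {for t, continuous (fun t : R => Num.max t 0)}.
  by apply: continuous_max; [exact: cvg_id | exact: cvg_cst].
have [t0|] := boolP (0 < t).
  have h : {for Num.max t 0, continuous (fun t => t `^ x)}.
    apply/differentiable_continuous/derivable1_diffP; rewrite max_l ?ltW//.
    by apply: derivable_powR; rewrite in_itv/= t0.
  exact: (@continuous_comp R R R (fun t => Num.max t 0) (fun t => t `^ x)).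
rewrite -leNgt => t0.
rewrite max_r// powR0 ?gt_eqF//.
apply/cvgrPdist_lt => e e0.
(* The [x]-th power stays below [e] as long as its base stays below this number. *)
have ex : 0 < e `^ x^-1 by rewrite powR_gt0.
near=> z.
rewrite sub0r normrN ger0_norm ?powR_ge0//.
rewrite -[ltRHS]powRr1 ?ltW// -(mulVf (lt0r_neq0 x0)) powRrM.
rewrite gt0_ltr_powR ?nnegrE ?powR_ge0 ?le_max ?lexx ?orbT//.
rewrite gt_max ex andbT.
by near: z; apply: lt_nbhsl; rewrite (le_lt_trans t0).
Unshelve. all: by end_near.
Qed.

Lemma GammaD1 x : 0 < x -> Gamma (x + 1) = \int[mu]_t gamma_integrand x t.
Proof.
move=> x0; rewrite /Gamma addrK.
rewrite [in RHS]/Rintegral /Rintegral; congr fine.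
rewrite integral_mkcond; apply: eq_integral => t _.
rewrite patchE mem_setE in_itv/= andbT /gamma_integrand.
by case: ltP => t0; rewrite ?powR0 ?gt_eqF ?mul0r.
Qed.
End gamma_integrand.

(** * Laplace's method for Euler's integral *)

Section laplace.
Context {R : realType}.
Let mu := @lebesgue_measure R.
Implicit Types s u x : R.

(** With [x = s ^ 2 / 2] and [t = x + s * u], one has [t / x = 1 + 2 * u / s]: this is the integrand
    at [t] divided by its peak value [x ^ x * e ^ - x] at [t = x]. *)
Definition laplace_kernel s u : R :=
  Num.max (1 + 2 * u / s) 0 `^ (s ^+ 2 / 2) * expR (- (s * u)).

Lemma laplace_kernel_ge0 s u : 0 <= laplace_kernel s u.
Proof. by rewrite mulr_ge0 ?powR_ge0 ?expR_ge0. Qed.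

Lemma gamma_integrand_laplace s u : 0 < s ->
  gamma_integrand (s ^+ 2 / 2) (s * u + s ^+ 2 / 2) =
  (s ^+ 2 / 2) `^ (s ^+ 2 / 2) * expR (- (s ^+ 2 / 2)) * laplace_kernel s u.
Proof.
move=> s0; have x0 : 0 < s ^+ 2 / 2 by rewrite divr_gt0 ?exprn_gt0.
rewrite /gamma_integrand /laplace_kernel opprD expRD.
have -> : Num.max (s * u + s ^+ 2 / 2) 0 = s ^+ 2 / 2 * Num.max (1 + 2 * u / s) 0.
  rewrite maxr_pMr ?ltW// mulr0; congr Num.max; field; lra.
have m0 : 0 <= Num.max (1 + 2 * u / s) 0 by rewrite le_max lexx orbT.
by rewrite (powRM _ (ltW x0) m0) [RHS]mulrACA [expR (- (s * u)) * _]mulrC.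
Qed.

Lemma continuous_laplace_kernel s : 0 < s -> continuous (laplace_kernel s).
Proof.
move=> s0; have x0 : 0 < s ^+ 2 / 2 by rewrite divr_gt0 ?exprn_gt0.
set c := (s ^+ 2 / 2) `^ (s ^+ 2 / 2) * expR (- (s ^+ 2 / 2)).
have c0 : c != 0 by rewrite mulf_neq0 ?gt_eqF ?powR_gt0 ?expR_gt0.
have -> : laplace_kernel s = (fun u => c^-1 * gamma_integrand (s ^+ 2 / 2) (s * u + s ^+ 2 / 2)).
  by apply/funext => u; rewrite gamma_integrand_laplace// mulKf.
move=> u; apply: cvgM; first exact: cvg_cst.
apply: (@continuous_comp R R R (fun u => s * u + s ^+ 2 / 2)); last exact: continuous_gamma_integrand.
by apply: cvgD; [apply: cvgM; [exact: cvg_cst|exact: cvg_id]|exact: cvg_cst].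
Qed.

(** Where the truncation is inactive, [s * u = s ^ 2 / 2 * y], which brings the exponent into the
    form controlled by the logarithm bounds. *)
Lemma laplace_kernelE s u : 0 < s -> - s < 2 * u -> let y := 2 * u / s in
  laplace_kernel s u = expR (s ^+ 2 / 2 * (ln (1 + y) - y)).
Proof.
move=> s0 us y.
have y0 : 0 < 1 + y by rewrite -ltrBlDl sub0r ltr_pdivlMr//; lra.
rewrite /laplace_kernel max_l -/y ?ltW// /powR gt_eqF// -expRD; congr expR.
rewrite /y; field; lra.
Qed.

(** The kernel is at most [e ^ - w] with [w = u ^ 2 / (1 + |u|)], which is free of [s], and [e ^ w
    >= 1 + w ^ 2 / 2 >= (1 + u ^ 2) / 4]. *)
Lemma laplace_kernel_le s u : 2 <= s -> laplace_kernel s u <= 4 * (1 + u ^+ 2)^-1.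
Proof.
move=> s2; have s0 : 0 < s by lra.
have q0 : 0 < 1 + u ^+ 2 by rewrite ltr_pwDl ?sqr_ge0.
have [us|us] := ltP (- s) (2 * u); last first.
  have y0 : 1 + 2 * u / s <= 0 by rewrite -lerBrDl sub0r ler_pdivrMr//; lra.
  rewrite /laplace_kernel max_r// powR0 ?mul0r; first by rewrite mulr_ge0 ?invr_ge0 ?ltW.
  by rewrite gt_eqF ?divr_gt0 ?exprn_gt0.
rewrite laplace_kernelE//.
set y := 2 * u / s.
have y1 : -1 < y by rewrite ltr_pdivlMr//; lra.
set w := u ^+ 2 / (1 + `|u|).
have w0 : 0 <= w by rewrite divr_ge0 ?sqr_ge0 ?addr_ge0.
have ule : s ^+ 2 / 2 * (ln (1 + y) - y) <= - w.
  apply: (@le_trans _ _ (s ^+ 2 / 2 * - (y ^+ 2 / (2 * (1 + `|y|))))).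
    by rewrite ler_wpM2l ?divr_ge0 ?sqr_ge0// ln1D_quadratic_ub.
  (* Here [2 <= s] removes [s] from the bound. *)
  have yu : `|y| <= `|u|.
    rewrite /y normrM normrM normfV gtr0_norm// (gtr0_norm s0) ler_pdivrMr//.
    have := normr_ge0 u; nra.
  rewrite mulrN lerN2 (_ : s ^+ 2 / 2 * _ = u ^+ 2 / (1 + `|y|)); last first.
    have : u = s * y / 2 by rewrite /y; field; lra.
    by have := normr_ge0 y; move: (y) (`|y|) => v n n0 ->; field; lra.
  rewrite ler_wpM2l ?sqr_ge0// lef_pV2 ?posrE; have := normr_ge0 y; lra.
apply: (@le_trans _ _ (expR (- w))); first by rewrite ler_expR.
rewrite expRN -[leRHS]invrK lef_pV2 ?posrE ?expR_gt0 ?invr_gt0 ?divr_gt0//.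
rewrite invfM invrK.
apply: le_trans (expR_ge1Dxn 1 w0).
(* [(1 + |u|) ^ 2 <= 2 * (1 + u ^ 2)] *)
have wlb : u ^+ 4 / (2 * (1 + u ^+ 2)) <= w ^+ 2.
  rewrite /w expr_div_n -exprM ler_wpM2l// ?exprn_even_ge0//.
  have nu : 0 < 1 + `|u| by rewrite ltr_pwDl.
  rewrite lef_pV2 ?posrE ?exprn_gt0 ?mulr_gt0//.
  rewrite -[u ^+ 2]real_normK ?num_real//.
  have := sqr_ge0 (1 - `|u|); lra.
apply: (@le_trans _ _ (1 + u ^+ 4 / (2 * (1 + u ^+ 2)) / 2)); last first.
  by rewrite lerD2l ler_wpM2r.
(* Over the common denominator, the numerator is [4 * (1 + u ^ 2) + u ^ 4 - (1 + u ^ 2) ^ 2]. *)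
rewrite -subr_ge0 (_ : _ - _ = (3 + 2 * u ^+ 2) / (4 * (1 + u ^+ 2))).
  by apply: divr_ge0; lra.
field; lra.
Qed.

Lemma integrable_laplace_kernel s : 2 <= s ->
  mu.-integrable setT (EFin \o laplace_kernel s).
Proof.
move=> s2; have s0 : 0 < s by lra.
apply: (le_integrable _ _ _ integrable_4oneDsqrV) => //.
  apply/measurable_EFinP; apply: continuous_measurable_fun.
  exact: continuous_laplace_kernel.
move=> u _ /=; rewrite lee_fin ger0_norm ?laplace_kernel_ge0//.
by apply: le_trans (ler_norm _); exact: laplace_kernel_le.
Qed.

(** Thanks to the truncation, the affine substitution [F] carries the whole line to itself, and its
    derivative supplies the factor [s]. *)
Lemma Gamma_laplace s : 2 <= s ->
  Gamma (s ^+ 2 / 2 + 1) =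
  (s ^+ 2 / 2) `^ (s ^+ 2 / 2) * expR (- (s ^+ 2 / 2)) * s * \int[mu]_u laplace_kernel s u.
Proof.
move=> s2; have s0 : 0 < s by lra.
have x0 : 0 < s ^+ 2 / 2 by rewrite divr_gt0 ?exprn_gt0.
set c := _ * s.
rewrite GammaD1// -RintegralZl//; last exact: integrable_laplace_kernel.
pose F u := s * u + s ^+ 2 / 2.
have dF u : is_derive u 1 F s by apply: is_derive_eq; rewrite /GRing.scale/=; lra.
have F' : F^`()%classic = cst s.
  by apply/funext => u; rewrite derive1E derive_val.
rewrite [LHS]/Rintegral (@increasing_ge0_integration_by_substitutionT _ F).
- congr fine; apply: eq_integral => u _.
  by rewrite /c F' [_ * s * _]mulrAC -gamma_integrand_laplace.
- by move=> a b ab; rewrite /F ltrD2r ltr_pM2l.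
- by rewrite F' => a; exact: cvg_cst.
- by rewrite F'; exact: is_cvg_cst.
- by rewrite F'; exact: is_cvg_cst.
- by move=> u; case: (dF u).
- apply: cvg_comp (cvg_addrr_Ny _); exact: gt0_cvgMrNy.
- apply: cvg_comp (cvg_addrr _); exact: gt0_cvgMry.
- exact: continuous_gamma_integrand.
- exact: gamma_integrand_ge0.
Qed.

Lemma laplace_kernel_cvg u : laplace_kernel s u @[s --> +oo] --> gauss_fun u.
Proof.
have H : (s ^+ 2 / 2 * (ln (1 + 2 * u / s) - 2 * u / s)) @[s --> +oo] --> - u ^+ 2.
  (* This is the error [s ^ 2 / 2 * |y| ^ 3 / (2 * (1 + y))] at [y = 2 * u / s]; the main term
     [s ^ 2 / 2 * y ^ 2 / 2] is exactly [u ^ 2]. *)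
  have lim0 : (fun s => 2 * `|u| ^+ 3 * (s + 2 * u)^-1) @ +oo --> (0 : R).
    rewrite -[X in _ --> X](mulr0 (2 * `|u| ^+ 3)).
    apply: cvgM; first exact: cvg_cst.
    apply/gtr0_cvgV0; last exact: cvg_addrr.
    near=> s; rewrite -ltrBlDr sub0r; near: s.
    exact: (nbhs_pinfty_gt (num_real _)).
  apply/cvgrPdist_le => e e0.
  move/cvgrPdist_le : lim0 => /(_ e e0) lim0.
  near=> s.
  have s0 : 0 < s by near: s; exact: (nbhs_pinfty_gt (num_real _)).
  have su : - (2 * u) < s by near: s; exact: (nbhs_pinfty_gt (num_real _)).
  have : `|0 - 2 * `|u| ^+ 3 * (s + 2 * u)^-1| <= e by near: s.
  apply: le_trans.
  set y := 2 * u / s.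
  have y1 : -1 < y by rewrite ltr_pdivlMr//; lra.
  rewrite (_ : - u ^+ 2 - _ = - (s ^+ 2 / 2 * (ln (1 + y) - y + y ^+ 2 / 2))); last first.
    rewrite /y; field; lra.
  rewrite normrN normrM ger0_norm ?divr_ge0 ?sqr_ge0//.
  have su0 : 0 < s + 2 * u by lra.
  rewrite sub0r normrN (ger0_norm (_ : 0 <= 2 * _ * _)); last first.
    by rewrite !mulr_ge0 ?exprn_ge0// invr_ge0 ltW.
  apply: (@le_trans _ _ (s ^+ 2 / 2 * (`|y| ^+ 3 / (2 * (1 + y))))).
    by rewrite ler_wpM2l ?divr_ge0 ?sqr_ge0// ln1D_quadratic_dist.
  rewrite le_eqVlt; apply/orP; left; apply/eqP.
  rewrite /y normrM normrM normfV gtr0_norm// (gtr0_norm s0); field.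
  by apply/andP; split; rewrite gt_eqF//; lra.
apply: (@cvg_trans _ ((fun s => expR (s ^+ 2 / 2 * (ln (1 + 2 * u / s) - 2 * u / s))) @ +oo)).
  apply: near_eq_cvg; near=> s.
  have s0 : 0 < s by near: s; exact: (nbhs_pinfty_gt (num_real _)).
  have us : - s < 2 * u by rewrite ltrNl; near: s; exact: (nbhs_pinfty_gt (num_real _)).
  by rewrite (laplace_kernelE s0 us).
apply: (cvg_comp _ _ H); exact: continuous_expR.
Unshelve. all: by end_near.
Qed.

Lemma Rintegral_laplace_kernel_cvg :
  (\int[mu]_u laplace_kernel s u) @[s --> +oo] --> Num.sqrt (pi : R).
Proof.
(* Dominated convergence is applied along an arbitrary sequence tending to infinity, shifted so that
   every term is at least 2. *)
apply/cvg_pinftyP => v v_oo.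
have [N _ v2] : \forall n \near \oo, 2 <= v n by move/cvgryPge : v_oo; exact.
rewrite -(cvg_shiftn N)/=.
have w2 n : 2 <= v (n + N)%N by apply: v2; exact: leq_addl.
have w_oo : v (n + N)%N @[n --> \oo] --> +oo.
  by rewrite (cvg_shiftn N).
have := @dominated_convergence _ _ R mu setT measurableT
  (fun n u => (laplace_kernel (v (n + N)%N) u)%:E) (fun u => (gauss_fun u)%:E)
  (fun u => (4 * (1 + u ^+ 2)^-1)%:E).
case.
- move=> n; apply/measurable_EFinP; apply: continuous_measurable_fun.
  by apply: continuous_laplace_kernel; exact: lt_le_trans (w2 n).
- by apply/measurable_EFinP; exact: measurable_gauss_fun.
- apply: aeW => u _; apply: cvg_EFin; first exact: nearW.
  by have /cvg_pinftyP := @laplace_kernel_cvg u; exact.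
- exact: integrable_4oneDsqrV.
- apply: aeW => u n _; rewrite lee_fin ger0_norm ?laplace_kernel_ge0//.
  exact: laplace_kernel_le.
move=> _ _; rewrite integralT_gauss; exact: fine_cvg.
Qed.
End laplace.

(** * Stirling's formula *)

Section stirling.
Context {R : realType}.
Implicit Types x : R.

Lemma Gamma_stirling :
  Gamma (x + 1) / (Num.sqrt (2 * pi) * (x `^ x * expR (- x) * Num.sqrt x)) @[x --> +oo]
    --> (1 : R).
Proof.
have pi0 := pi_gt0 R.
have sqrt_oo : (fun x : R => Num.sqrt (2 * x) : R) @ +oo --> +oo.
  apply/cvgryPge => A; near=> x.
  apply: le_trans (ler_norm A) _; rewrite -sqrtr_sqr; apply: ler_wsqrtr.
  rewrite mulrC -ler_pdivrMr//; near: x; exact: (nbhs_pinfty_ge (num_real _)).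
(* With [s = sqrt (2 * x)], the quotient is the kernel integral divided by [sqrt pi]. *)
have := cvgM (cvg_comp _ _ sqrt_oo (@Rintegral_laplace_kernel_cvg R))
  (cvg_cst (Num.sqrt (pi : R))^-1).
rewrite divff ?gt_eqF ?sqrtr_gt0//.
move=> /(_ _ _); apply: cvg_trans; apply: near_eq_cvg; near=> x => /=.
have x0 : 0 < x by near: x; exact: (nbhs_pinfty_gt (num_real _)).
have s2 : 2 <= Num.sqrt (2 * x) by near: x; move/cvgryPge : sqrt_oo; exact.
have := Gamma_laplace s2.
rewrite sqr_sqrtr ?mulr_ge0 ?ltW// [2 * x]mulrC mulfK// => ->.
rewrite !sqrtrM ?ltW//.
have p1 : x `^ x != 0 by rewrite gt_eqF ?powR_gt0.
have p2 : expR (- x) != 0 by rewrite gt_eqF ?expR_gt0.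
have p3 : Num.sqrt x != 0 by rewrite gt_eqF ?sqrtr_gt0.
have p4 : Num.sqrt 2 != 0 :> R by rewrite gt_eqF ?sqrtr_gt0.
have p5 : Num.sqrt pi != 0 :> R by rewrite gt_eqF ?sqrtr_gt0.
by field; apply/and5P; split.
Unshelve. all: by end_near.
Qed.
End stirling.

(** * First-order behaviour of a mean near the diagonal *)

Section mean.
Context (R : realType) (f : R -> R -> R).
Context (f_mean : is_mean `]0, +oo[ f) (f_sym : symmetric_on `]0, +oo[ f).
Context (f_hom : homogeneous_on `]0, +oo[ f) (f_diff : differentiable_on `]0, +oo[ f).
Let p : R * R := (1, 1).
Let F (p : R * R) := f p.1 p.2.

Let F_diff : differentiable F p.
Proof. by apply: f_diff; rewrite /= in_itv/= ltr01. Qed.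

Let F_diag (x : R) : 0 < x -> f x x = x.
Proof.
move=> x0; have x_ : `]0, +oo[%classic x by rewrite /= in_itv/= x0.
have := f_mean x_ x_; rewrite minxx maxxx => fx.
by apply/eqP; rewrite eq_le andbC.
Qed.

Let F_slope (v : R * R) :
  (fun h : R => h^-1 * (f (h * v.1 + 1) (h * v.2 + 1) - 1)) @ 0^' --> 'd F p v.
Proof.
rewrite -deriveE//.
have := @diff_derivable _ _ _ F p v F_diff.
rewrite {3}(_ : 1 = F p); first exact.
by rewrite /F F_diag.
Qed.

(** Symmetry exchanges the two partial derivatives, and [f x x = x] makes the derivative along
    [(1, 1)], which is their sum, equal to 1. *)
Let dF_basis : 'd F p (1, 0) = 2^-1 /\ 'd F p (0, 1) = 2^-1.
Proof.
have dF_swap : 'd F p (1, 0) = 'd F p (0, 1).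
  apply: (cvg_unique _ (@F_slope (1, 0))) => //=.
  apply: cvg_trans (@F_slope (0, 1)).
  apply: near_eq_cvg.
  apply: (@nbhs_dnbhs _ (0 : R)); near=> h.
  have h1 : -1 < h by near: h; apply: lt_nbhsr; rewrite ltrN10.
  by rewrite /= !mulr1 !mulr0 !add0r f_sym// /= in_itv/= andbT; lra.
have dF_sum : 'd F p (1, 1) = 1.
  apply: (cvg_unique _ (@F_slope (1, 1))) => //=.
  apply: (@cvg_trans _ (cst (1 : R) h @[h --> 0^'])); last exact: cvg_cst.
  apply: near_eq_cvg.
  near=> h.
  have h0 : h != 0 by near: h; exact: nbhs_dnbhs_neq.
  have h1 : -1 < h by near: h; apply: nbhs_dnbhs; apply: lt_nbhsr; rewrite ltrN10.
  by rewrite /= !mulr1 F_diag ?addrK ?mulVf//; lra.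
have : 'd F p (1, 1) = 'd F p (1, 0) + 'd F p (0, 1).
  by rewrite -linearD; congr ('d F p _); congr pair; rewrite ?addr0 ?add0r.
by rewrite dF_sum dF_swap; split; lra.
Unshelve. all: by end_near.
Qed.

Lemma mean_cvg_slope (a b : R) :
  (fun x => x * (f (1 + a / x) (1 + b / x) - 1)) @ +oo --> (a + b) / 2.
Proof.
have -> : (a + b) / 2 = 'd F p (a, b).
  have [D1 D2] := dF_basis.
  have -> : (a, b) = a *: ((1, 0) : R * R) + b *: ((0, 1) : R * R).
    by congr pair; rewrite /= !scaler0 ?addr0 ?add0r /GRing.scale/= mulr1.
  by rewrite linearD !linearZ D1 D2 /GRing.scale/= mulrDl.
(* The step of the difference quotient is [h = 1 / x], which must approach 0 without reaching it. *)
have inv_dnbhs : (fun x : R => x^-1) @ +oo --> (0 : R)^'.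
  move=> A; rewrite /dnbhs/= /within/= => A0.
  have inv0 : (fun x : R => x^-1) @ +oo --> (0 : R).
    by apply/gtr0_cvgV0; [exact: nbhs_pinfty_gt|exact: cvg_id].
  have {}A0 : \forall x \near +oo, (x : R)^-1 != 0 -> A x^-1 := inv0 _ A0.
  apply: filterS2 A0 (nbhs_pinfty_gt (num_real (0 : R))) => x Ax x0.
  by apply: Ax; rewrite invr_neq0 ?gt_eqF.
have := cvg_comp _ _ inv_dnbhs (@F_slope (a, b)).
apply: cvg_trans; apply: near_eq_cvg; near=> x.
by rewrite /= invrK ![x^-1 * _]mulrC ![_ + 1]addrC.
Unshelve. all: by end_near.
Qed.

(** By homogeneity [x] factors out of [f (x + a) (x + b)] as soon as [x], [x + a] and [x + b] are
    positive. *)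
Lemma mean_cvg (a b : R) :
  (fun x => f (x + a) (x + b) - x) @ +oo --> (a + b) / 2.
Proof.
apply: cvg_trans (@mean_cvg_slope a b).
apply: near_eq_cvg; near=> x.
have x0 : 0 < x by near: x; exact: (nbhs_pinfty_gt (num_real _)).
have Hxa : 0 < x + a by rewrite -ltrBlDr sub0r; near: x; exact: (nbhs_pinfty_gt (num_real _)).
have Hxb : 0 < x + b by rewrite -ltrBlDr sub0r; near: x; exact: (nbhs_pinfty_gt (num_real _)).
have xa : 0 < 1 + a / x by rewrite (_ : _ + _ = (x + a) / x) ?divr_gt0//; field; lra.
have xb : 0 < 1 + b / x by rewrite (_ : _ + _ = (x + b) / x) ?divr_gt0//; field; lra.
rewrite mulrBr mulr1 -f_hom//=; [|by rewrite in_itv/= andbT..].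
congr (f _ _ - _); field; lra.
Unshelve. all: by end_near.
Qed.
End mean.

(** * Comparison with Stirling's formula *)

Lemma mulr_ln_ratio_cvg (R : realType) (m : R -> R) (d : R) :
  m x - x @[x --> +oo] --> d ->
  (x + 2^-1) * ln (m x / x) @[x --> +oo] --> d.
Proof.
move=> md.
have invx0 : (fun x : R => x^-1) @ +oo --> (0 : R).
  by apply/gtr0_cvgV0; [exact: (nbhs_pinfty_gt (num_real _))|exact: cvg_id].
have h1 : (fun x : R => 1 + 2^-1 * x^-1) @ +oo --> (1 : R).
  rewrite -[X in _ --> X]addr0 -[X in _ + X](mulr0 2^-1).
  by apply: cvgD; [exact: cvg_cst|apply: cvgM; [exact: cvg_cst|exact: invx0]].
have q0 : (fun x : R => 1 + (m x - x) * x^-1) @ +oo --> (1 : R).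
  rewrite -[X in _ --> X]addr0 -[X in _ + X](mulr0 d).
  by apply: cvgD; [exact: cvg_cst|apply: cvgM; [exact: md|exact: invx0]].
(* With [y = (m x - x) / x], these limits bracket the claim through
   [y / (1 + y) <= ln (1 + y) <= y], because [(x + 1 / 2) * y = (1 + 1 / (2 * x)) * (m x - x)]. *)
have ub : (fun x : R => (1 + 2^-1 * x^-1) * (m x - x)) @ +oo --> d.
  by rewrite -[X in _ --> X]mul1r; apply: cvgM.
have lb : (fun x : R => (1 + 2^-1 * x^-1) * (m x - x) * (1 + (m x - x) * x^-1)^-1) @ +oo --> d.
  rewrite (_ : d = d * 1^-1); last by rewrite invr1 mulr1.
  apply: cvgM; first exact: ub.
  by apply: cvgV => //; rewrite oner_neq0.
apply: squeeze_cvgr lb ub; near=> x.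
have x0 : 0 < x by near: x; exact: (nbhs_pinfty_gt (num_real _)).
have y0 : 0 < 1 + (m x - x) * x^-1 by near: x; exact: (cvgr_gt 1 q0).
have -> : m x / x = 1 + (m x - x) / x by field; lra.
have -> : (1 + 2^-1 * x^-1) * (m x - x) = (x + 2^-1) * ((m x - x) / x) by field; lra.
have x2 : 0 < x + 2^-1 by rewrite addr_gt0.
have y1 : -1 < (m x - x) / x by lra.
by rewrite -mulrA !ler_pM2l// ln1D_lb//= le_ln1Dx.
Unshelve. all: by end_near.
Qed.

Theorem theorem1 (R : realType) (M N : R -> R -> R) (r : R -> R)
    (theta theta' sigma sigma' : R)
    (M_mean : is_mean `]0, +oo[ M)
    (M_sym : symmetric_on `]0, +oo[ M)
    (M_hom : homogeneous_on `]0, +oo[ M)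
    (M_diff : differentiable_on `]0, +oo[ M)
    (N_mean : is_mean setT N)
    (N_sym : symmetric_on setT N)
    (N_hom : homogeneous_on setT N)
    (N_diff : differentiable_on setT N)
    (r_lim : r x @[x --> +oo] --> (0 : R))
    (theta_sum : theta + theta' = 1)
    (sigma_sum : sigma + sigma' = 1) :
  asymptotic_on
    [set x | - Num.min 1 (Num.min theta theta') < x]
    (fun x => Gamma (x + 1))
    (fun x => Num.sqrt (2 * pi) * M (x + theta) (x + theta') `^ (x + 2^-1)
              * expR (- N (x + sigma) (x + sigma')) * expR (r x)).
Proof.
have M_cvg : (fun x => M (x + theta) (x + theta') - x) @ +oo --> (2^-1 : R).
  by rewrite -[2^-1]mul1r -[X in X / _]theta_sum; exact: mean_cvg.
have N_cvg : (fun x => N (x + sigma) (x + sigma') - x) @ +oo --> (2^-1 : R).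
  rewrite -[2^-1]mul1r -[X in X / _]sigma_sum; apply: mean_cvg.
  - by move=> a b _ _; exact: N_mean.
  - by move=> a b _ _; exact: N_sym.
  - by move=> a b t _ _; exact: N_hom.
  - by move=> a b _ _; exact: N_diff.
rewrite /asymptotic_on; apply: cvg_trans; first exact: (cvg_app _ (cvg_within _)).
(* This is the logarithm of Stirling's approximation divided by the right-hand side; the two limits
   [1 / 2] cancel. *)
have E_cvg : (fun x => N (x + sigma) (x + sigma') - x
    - (x + 2^-1) * ln (M (x + theta) (x + theta') / x) - r x) @ +oo --> (0 : R).
  have -> : 0 = 2^-1 - 2^-1 - 0 :> R by lra.
  by apply: cvgB r_lim; apply: cvgB N_cvg _; exact: mulr_ln_ratio_cvg.
have := cvgM (@Gamma_stirling R) (cvg_comp _ _ E_cvg (@continuous_expR R 0)).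
rewrite expR0 mulr1.
move=> /(_ _ _); apply: cvg_trans; apply: near_eq_cvg; near=> x => /=.
have x0 : 0 < x by near: x; exact: (nbhs_pinfty_gt (num_real _)).
(* Positivity turns the power of [M] into an exponential of a logarithm; it follows from
   [M - x > - 1 / 2] and [x > 1]. *)
have M0 : 0 < M (x + theta) (x + theta').
  have xM : 2^-1 - 1 < M (x + theta) (x + theta') - x.
    by near: x; apply: (cvgr_gt _ M_cvg); lra.
  have x1 : 1 < x by near: x; exact: (nbhs_pinfty_gt (num_real _)).
  lra.
have -> : x `^ x * expR (- x) * Num.sqrt x = expR ((x + 2^-1) * ln x - x).
  by rewrite -(powR12_sqrt (ltW x0)) /powR gt_eqF// mulrAC -!expRD mulrDl.
rewrite [M _ _ `^ _]/powR gt_eqF// ln_div ?posrE//.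
rewrite !invfM -!expRN -!mulrA -!expRD; congr (_ * (_ * expR _)); ring.
Unshelve. all: by end_near.
Qed.
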